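(* Every compact holomorphic topological semigroup is abundant. That is, if $(S,\tau)$ is a compact right topological holomorphic semigroup, then every left ideal of $S$ includes a minimal left ideal of $S$, and every minimal left ideal of $S$ contains an idempotent; symmetrically, if $(S,\tau)$ is a compact left topological holomorphic semigroup, then every right ideal of $S$ includes a minimal right ideal of $S$, and every minimal right ideal of $S$ contains an idempotent.
   Context: A holomorphic semigroup $S$ is a non-empty set of holomorphic self-maps of a fixed set $X$ (where $X$ is $\mathbb{C}$, the Riemann sphere $\mathbb{C}_\infty$, or a fixed open subset thereof) that is closed under composition $\circ$; it is regarded as a semigroup under $\circ$. For $g\in S$, the right translation map is $h \mapsto h\circ g$ and the left translation map is $h \mapsto g \circ h$. A compact right (respectively left) topological holomorphic semigroup is a pair $(S,\tau)$ where $S$ is a holomorphic semigroup and $\tau$ is a compact Hausdorff topology on $S$ for which every right (respectively left) translation map $S\to S$ is continuous (no continuity on the other side is required). A non-empty subset $I \subseteq S$ is a left (respectively right) ideal if $f\circ h \in I$ (respectively $h \circ f\in I$) for all $f\in S$, $h \in I$. A left (respectively right) ideal $M$ is minimal if every left (respectively right) ideal $I$ of $S$ with $I\subseteq M$ satisfies $I = M$. An idempotent is an element $e\in S$ with $e\circ e = e$. A holomorphic semigroup is abundant (in the left, respectively right, sense) if every left (respectively right) ideal includes a minimal left (respectively right) ideal and every minimal left (respectively right) ideal contains an idempotent. *)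

(* Defs.v *)
From HB Require Import structures.
From mathcomp Require Import all_boot all_order all_algebra.
From mathcomp Require Import complex.
From mathcomp Require Import all_classical all_reals all_analysis.
Import Order.TTheory GRing.Theory Num.Theory.
Import numFieldNormedType.Exports.

Set Implicit Arguments.
Unset Strict Implicit.
Unset Printing Implicit Defensive.

Local Open Scope classical_set_scope.
Local Open Scope ring_scope.

Section RiemannSphere.
Variable R : realType.

(* Packing R[i] as a numClosedFieldType is what gives it the norm topology
   of numFieldNormedType. *)
Definition Cplx : numClosedFieldType := R[i].

Definition sphere : topologicalType := one_point_compactification Cplx.

Definition infty : sphere := None.

(* The standard local coordinate around [p]: z itself if [p] is finite,
   1/z if [p] is infinity.  [chart p] is only meaningful near [p]; outside of
   its chart it takes the value 0. *)
Definition chart (p : sphere) : sphere -> Cplx :=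
  if p is Some _ then fun q => if q is Some z then z else 0
  else fun q => if q is Some z then z^-1 else 0.

Definition chart_inv (p : sphere) : Cplx -> sphere :=
  if p is Some _ then fun z => Some z
  else fun z => if z == 0 then infty else Some z^-1.

(* Continuity has to be required separately, because of the value that
   [chart (F p)] takes outside of its chart.  The scalars are complex, so
   [derivable _ _ 1] is complex differentiability. *)
Definition complex_differentiable_at (F : sphere -> sphere) (p : sphere) :=
  {for p, continuous F} /\
  derivable (chart (F p) \o F \o chart_inv p : Cplx^o -> Cplx^o) (chart p p) 1.

(* The values outside of X are immaterial for local properties at the points
   of X when X is open. *)
Definition extension (X : set sphere) (f : X -> X) (p : sphere) : sphere :=
  oapp (fun x : X => set_val (f x)) p (insub p).

Definition holomorphic (X : set sphere) (f : X -> X) :=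
  forall p, X p -> complex_differentiable_at (extension f) p.

(* For X an open subset of the sphere; this includes the sphere itself, the
   plane and the open subsets of the plane. *)
Record holomorphic_semigroup (X : set sphere) := HolomorphicSemigroup {
  hs_set :> set (X -> X);
  hs_nonempty : hs_set !=set0;
  hs_holomorphic : forall f, hs_set f -> holomorphic f;
  hs_comp : forall f g, hs_set f -> hs_set g -> hs_set (f \o g) }.

End RiemannSphere.

Record topology (T : Type) := Topology {
  opens : set (set T);
  opensT : opens setT;
  opensI : forall A B, opens A -> opens B -> opens (A `&` B);
  opens_bigU : forall (I : Type) (F : I -> set T),
    (forall i, opens (F i)) -> opens (\bigcup_i F i) }.

Definition topologized (T : Type) (tau : topology T) : Type := T.

HB.instance Definition _ (T : Type) (tau : topology T) :=
  gen_eqMixin (topologized tau).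
HB.instance Definition _ (T : Type) (tau : topology T) :=
  gen_choiceMixin (topologized tau).
HB.instance Definition _ (T : Type) (tau : topology T) :=
  isOpenTopological.Build (topologized tau)
    (opensT tau) (@opensI T tau) (@opens_bigU T tau).

Section Semigroups.
Variables (R : realType) (X : set (sphere R)) (S : holomorphic_semigroup X).

Definition hs_mul (f g : S) : S :=
  SigSub (mem_set (hs_comp (set_valP f) (set_valP g))).

Definition compact_right_topological (tau : topology S) :=
  [/\ compact [set: topologized tau],
      hausdorff_space (topologized tau) &
      forall g : S,
        continuous ((fun h => hs_mul h g) : topologized tau -> topologized tau)].

Definition compact_left_topological (tau : topology S) :=
  [/\ compact [set: topologized tau],
      hausdorff_space (topologized tau) &
      forall g : S,
        continuous ((fun h => hs_mul g h) : topologized tau -> topologized tau)].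

Definition left_ideal (I : set (X -> X)) :=
  [/\ I !=set0, I `<=` S & forall f h, hs_set S f -> I h -> I (f \o h)].

Definition right_ideal (I : set (X -> X)) :=
  [/\ I !=set0, I `<=` S & forall f h, hs_set S f -> I h -> I (h \o f)].

Definition minimal_left_ideal (M : set (X -> X)) :=
  left_ideal M /\ forall I, left_ideal I -> I `<=` M -> I = M.

Definition minimal_right_ideal (M : set (X -> X)) :=
  right_ideal M /\ forall I, right_ideal I -> I `<=` M -> I = M.

Definition is_idempotent (e : X -> X) := hs_set S e /\ e \o e = e.

Definition left_abundant :=
  (forall I, left_ideal I -> exists2 M, minimal_left_ideal M & M `<=` I) /\
  (forall M, minimal_left_ideal M -> exists2 e, M e & is_idempotent e).

Definition right_abundant :=
  (forall I, right_ideal I -> exists2 M, minimal_right_ideal M & M `<=` I) /\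
  (forall M, minimal_right_ideal M -> exists2 e, M e & is_idempotent e).

End Semigroups.

(* Main.v *)
Require Import Defs.
From mathcomp Require Import all_boot all_order all_algebra.
From mathcomp Require Import all_classical all_reals all_analysis.

(** The Ellis-Numakura argument; holomorphy plays no role.  By compactness,
   Zorn's lemma yields minimal closed left ideals and minimal closed
   subsemigroups.  As [S h] is closed for every [h], being a continuous image of
   a compact set, minimal closed left ideals are minimal left ideals and
   minimal left ideals are closed.  A minimal closed subsemigroup [A] of a
   minimal left ideal satisfies [A a = A] for [a] in [A], hence so does
   [A = {x in A | x a = a}], and therefore [a a = a].  The claim on right ideals
   is the one on left ideals for the opposite product. *)

Set Implicit Arguments.
Unset Strict Implicit.
Unset Printing Implicit Defensive.

Local Open Scope classical_set_scope.

Section CompactSpaces.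
Variable T : topologicalType.
Hypothesis compactT : compact [set: T].

(** A chain of non-empty sets is a filter base. Compactness gives its filter a cluster point, which
    lies in every closed member. *)
Lemma bigcap_closed_chain_nonempty (C : set (set T)) :
  (forall A, C A -> closed A /\ A !=set0) -> total_on C subset ->
  C !=set0 -> \bigcap_(A in C) A !=set0.
Proof.
move=> clC totC C0; pose F := filter_from C id.
have FF : ProperFilter F.
  apply: filter_from_proper => [|A /clC[]//].
  apply: filter_from_filter => // A B CA CB.
  case: (totC A B CA CB) => sub; [exists A | exists B] => // x xA;
    by split => //; exact: sub.
have [p [_]] := compactT FF filterT.
rewrite clusterE => clp; exists p => A CA.
by have [clA _] := clC A CA; apply: clA; apply: clp; exists A.
Qed.

(** Zorn's lemma is applied to the sets [B] removed from [A0], so that unions of chains become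
    intersections of closed sets. [K] will be either absorption or stability under the product. *)
Lemma minimal_closed_subset (K : set (set T)) (A0 : set T) :
  (forall F, F `<=` K -> K (\bigcap_(A in F) A)) ->
  closed A0 -> A0 !=set0 -> K A0 ->
  exists M, [/\ M `<=` A0, closed M, M !=set0, K M &
    forall N, closed N -> N !=set0 -> K N -> N `<=` M -> N = M].
Proof.
move=> capK clA0 A00 KA0; pose Q := [set A | [/\ closed A, A !=set0 & K A]].
have [F FQ totF|B [[clM M0 KM] maxB]] := @Zorn_bigcup T [set B | Q (A0 `\` B)].
  (* The empty chain is separate: it leaves [A0] itself, whereas the intersection over an empty [C]
     would be the whole space. *)
  have [->|/set0P F0] := eqVneq F set0; first by rewrite /= bigcup_set0 setD0.
  pose C := [set A0 `\` X | X in F].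
  rewrite /=; have -> : A0 `\` \bigcup_(X in F) X = \bigcap_(A in C) A.
    apply/seteqP; split=> [x [A0x nx] _ [X FX <-]|x xC].
      by split=> // Xx; apply: nx; exists X.
    have [X FX] := F0.
    split=> [|[Y FY Yx]]; first by have [] := xC _ (ex_intro2 _ _ X FX erefl).
    by have [_] := xC _ (ex_intro2 _ _ Y FY erefl); apply.
  have CQ A : C A -> Q A by move=> [X FX <-]; exact: FQ.
  split.
  - by apply: closed_bigI => A /CQ[].
  - apply: bigcap_closed_chain_nonempty => [A /CQ[]//| |].
    + move=> _ _ [X FX <-] [Y FY <-].
      by case: (totF X Y FX FY) => ?; [right|left]; exact: setDS.
    + by have [X FX] := F0; exists (A0 `\` X), X.
  - by apply: capK => A /CQ[].
exists (A0 `\` B); split => // N clN N0 KN NM.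
apply/seteqP; split => // x [A0x nBx]; apply: contrapT => nNx.
(* A point [x] of [M] outside [N] would make the complement of [N] a strictly larger admissible set
   than [B]. *)
apply: (maxB (~` N)).
  split=> [y By Ny|/(_ x nNx)//].
  by have [] := NM y Ny.
rewrite /=; suff -> : A0 `\` ~` N = N by [].
by rewrite setDE setCK; apply/setIidr => y /NM[].
Qed.

End CompactSpaces.

Section CompactSemigroups.
Variables (T : topologicalType) (mul : T -> T -> T).
Hypotheses (compactT : compact [set: T]) (hausT : hausdorff_space T).
Hypothesis mulA : associative mul.
Hypothesis continuous_mulr : forall g, continuous (mul^~ g).

(** Non-emptiness is left out so that the property is stable under arbitrary intersections, as
    [minimal_closed_subset] demands. *)
Definition absorbing (A : set T) := forall f h, A h -> A (mul f h).

Definition minimal_absorbing (M : set T) :=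
  [/\ M !=set0, absorbing M &
    forall N, N !=set0 -> absorbing N -> N `<=` M -> N = M].

Lemma closed_mulr_image (A : set T) g : closed A -> closed (mul^~ g @` A).
Proof.
move=> clA; apply: compact_closed => //; apply: continuous_compact.
  exact/continuous_subspaceT/continuous_mulr.
exact: subclosed_compact clA compactT _.
Qed.

Lemma absorbing_range h : absorbing (range (mul^~ h)).
Proof. by move=> f _ [g _ <-]; exists (mul f g) => //; rewrite mulA. Qed.

Lemma range_subset_absorbing I h :
  absorbing I -> I h -> range (mul^~ h) `<=` I.
Proof. by move=> absI Ih _ [g _ <-]; exact: absI. Qed.

Lemma minimal_absorbing_exists I : I !=set0 -> absorbing I ->
  exists2 M, minimal_absorbing M & M `<=` I.
Proof.
move=> [h Ih] absI.
have [|||M [MTh clM M0 absM minM]] :=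
    @minimal_closed_subset _ compactT absorbing (range (mul^~ h)) _ _ _
      (@absorbing_range h).
- by move=> F FK f g capg A FA; apply: (FK A FA); exact: capg.
- exact: closed_mulr_image.
- by exists (mul h h), h.
exists M; last exact: subset_trans MTh (range_subset_absorbing absI Ih).
split=> // N [j Nj] absN NM; apply/seteqP; split => //.
(* [M] is so far minimal only among closed sets. [N] need not be closed, but it contains the closed
   absorbing set of all products [mul g j], which must then be [M]. *)
have TjN := range_subset_absorbing absN Nj.
rewrite -(minM (range (mul^~ j))) //.
- exact: closed_mulr_image.
- by exists (mul j j), j.
- exact: absorbing_range.
- exact: subset_trans TjN NM.
Qed.

Lemma idempotent_in_closed_subsemigroup (B : set T) :
  closed B -> B !=set0 -> (forall f g, B f -> B g -> B (mul f g)) ->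
  exists2 e, B e & mul e e = e.
Proof.
move=> clB B0 mulB.
have [|A [AB clA [a Aa] mul_closedA minA]] := @minimal_closed_subset _ compactT
    [set A | forall f g, A f -> A g -> A (mul f g)] B _ clB B0 mulB.
  by move=> F FK f g Ff Fg A FA; apply: (FK A FA); [exact: Ff|exact: Fg].
have Aa_A : mul^~ a @` A = A.
  apply: minA.
  - exact: closed_mulr_image.
  - by exists (mul a a), a.
  - move=> _ _ [x Ax <-] [y Ay <-]; exists (mul (mul x a) y); last by rewrite !mulA.
    by apply: (mul_closedA) => //; exact: mul_closedA.
  - by move=> _ [x Ax <-]; exact: mul_closedA.
exists a; first exact: AB.
(* Once every element of [A] fixes [a] by left multiplication, [a] itself does, which is
   idempotency. *)
suff fixA : A `&` mul^~ a @^-1` [set a] = A by move: Aa; rewrite -{1}fixA => -[].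
apply: minA => [|||x []//].
- apply: closedI => //; apply: preimage_closed => [x _|]; first exact: continuous_mulr.
  exact/accessible_closed_set1/hausdorff_accessible.
(* The equality [Aa_A] serves here: it solves [mul x a = a] in [A]. *)
- by move: (Aa); rewrite -{1}Aa_A => -[x Ax xa]; exists x.
- move=> f g [Af fa] [Ag ga]; split; first exact: mul_closedA.
  by rewrite /= -mulA [mul g a]ga.
Qed.

Lemma idempotent_in_minimal_absorbing M : minimal_absorbing M ->
  exists2 e, M e & mul e e = e.
Proof.
move=> [[h Mh] absM minM]; have M0 : M !=set0 by exists h.
apply: idempotent_in_closed_subsemigroup => // [|f g _ Mg]; last exact: absM.
rewrite -(minM (range (mul^~ h))).
- exact: closed_mulr_image.
- by exists (mul h h), h.
- exact: absorbing_range.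
- exact: range_subset_absorbing.
Qed.

End CompactSemigroups.

(** [op] is composition for left ideals and reversed composition for right
   ideals. *)
Definition op_ideal (F : Type) (op : F -> F -> F) (S I : set F) :=
  [/\ I !=set0, I `<=` S & forall f h, S f -> I h -> I (op f h)].

Definition minimal_op_ideal (F : Type) (op : F -> F -> F) (S M : set F) :=
  op_ideal op S M /\ forall I, op_ideal op S I -> I `<=` M -> I = M.

Section Transport.
Variables (F : Type) (op : F -> F -> F) (S : set F).
Variables (T : topologicalType) (mul : T -> T -> T) (v : T -> F).
Hypotheses (v_inj : injective v) (range_v : range v = S).
Hypothesis v_mul : {morph v : f g / mul f g >-> op f g}.

(** The topology lives on a type of elements of [S], while ideals are sets of functions. Images and
    preimages under the inclusion [v] pass between the two. *)
Lemma op_ideal_image (A : set T) :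
  A !=set0 -> absorbing mul A -> op_ideal op S (v @` A).
Proof.
move=> [h Ah] absA; split; first by exists (v h), h.
  by rewrite -range_v; exact: image_subset.
move=> f g; rewrite -range_v => -[x _ <-] [y Ay <-].
by exists (mul x y); [exact: absA|exact: v_mul].
Qed.

Lemma image_preimage_op_ideal I : op_ideal op S I -> v @` (v @^-1` I) = I.
Proof.
move=> [_ IS _]; apply/seteqP; split=> [|x Ix]; first exact: image_preimage_subset.
by move: (IS x Ix); rewrite -range_v => -[y _ yx]; exists y => //=; rewrite yx.
Qed.

Lemma preimage_op_ideal I : op_ideal op S I ->
  v @^-1` I !=set0 /\ absorbing mul (v @^-1` I).
Proof.
move=> idI; have [I0 IS opI] := idI; split.
  by move: I0; rewrite -{1}(image_preimage_op_ideal idI) => -[_ [x Ix _]]; exists x.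
by move=> f h Ih; rewrite /= v_mul; apply: opI => //; rewrite -range_v; exists f.
Qed.

Lemma minimal_op_ideal_image (M : set T) :
  minimal_absorbing mul M -> minimal_op_ideal op S (v @` M).
Proof.
move=> [M0 absM minM]; split=> [|I idI IM]; first exact: op_ideal_image.
have [I0 absI] := preimage_op_ideal idI.
rewrite -(image_preimage_op_ideal idI) (minM _ I0 absI) // => x Ix.
by have [y My /v_inj <-] := IM _ Ix.
Qed.

Lemma minimal_absorbing_preimage M :
  minimal_op_ideal op S M -> minimal_absorbing mul (v @^-1` M).
Proof.
move=> [idM minM]; have [M0 absM] := preimage_op_ideal idM.
(* The image of [N] is an ideal inside [M], hence [M]; injectivity of [v] then recovers [N] as the
   preimage. *)
split=> // N N0 absN NM; rewrite -(minM (v @` N)).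
- by apply/seteqP; split=> [x Nx|x [y Ny /v_inj <-]//]; exists x.
- exact: op_ideal_image.
- by move=> _ [x /NM Mx <-].
Qed.

Hypotheses (compactT : compact [set: T]) (hausT : hausdorff_space T).
Hypothesis continuous_mulr : forall g, continuous (mul^~ g).
Hypothesis opA : associative op.

Lemma op_ideals_abundant :
  (forall I, op_ideal op S I ->
    exists2 M, minimal_op_ideal op S M & M `<=` I) /\
  (forall M, minimal_op_ideal op S M ->
    exists2 e, M e & S e /\ op e e = e).
Proof.
have mulA : associative mul by move=> f g h; apply: v_inj; rewrite !v_mul opA.
split=> [I idI|M minM].
  have [I0 absI] := preimage_op_ideal idI.
  have [M minM MI] :=
    minimal_absorbing_exists compactT hausT mulA continuous_mulr I0 absI.
  exists (v @` M); first exact: minimal_op_ideal_image.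
  by move=> _ [x /MI Ix <-].
have [e Me ee] := idempotent_in_minimal_absorbing compactT hausT mulA
  continuous_mulr (minimal_absorbing_preimage minM).
exists (v e) => //; split; first by case: minM => -[_ MS _] _; exact: MS.
by rewrite -v_mul ee.
Qed.

End Transport.

Theorem theorem2p2 (R : realType) (X : set (sphere R)) (hX : open X)
    (S : holomorphic_semigroup X) (tau : topology S) :
  (compact_right_topological tau -> left_abundant S) /\
  (compact_left_topological tau -> right_abundant S).
Proof.
have range_val : range (set_val : S -> (X -> X)) = hs_set S.
  apply/seteqP; split=> [_ [f _ <-]|f Sf]; first exact: set_valP.
  by exists (SigSub (mem_set Sf)).
split=> -[cpt haus cont].
  exact: (@op_ideals_abundant (X -> X) (fun f h => f \o h) _ (topologized tau)
    (@hs_mul R X S) set_val val_inj range_val _ cpt haus cont).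
(* Right translations for the reversed product are the left translations of [S], whose continuity is
   [cont]. *)
exact: (@op_ideals_abundant (X -> X) (fun f h => h \o f) _ (topologized tau)
  (fun f h => hs_mul h f) set_val val_inj range_val _ cpt haus cont).
Qed.
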